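(* Let $\mathbb{H}$ be a Hilbert space and let $T$ be a positive linear relation on $\mathbb{H}$. Then the following are equivalent: (1) $(\operatorname{dom}(T))^\perp=\{0\}$ and $T^*=T$; (2) there exists a linear operator $S$ on $\mathbb{H}$ (defined on a linear subspace $\operatorname{dom}(S)\subseteq\mathbb{H}$) such that $G(S)=T\cap T^*$ and $\operatorname{ran}(I+S)=\mathbb{H}$.
   Context: A linear relation on $\mathbb{H}$ is a linear subspace $T$ of $\mathbb{H}\times\mathbb{H}$ (not assumed closed). Ordered pairs in $\mathbb{H}\times\mathbb{H}$ are written $\{f,f'\}$. The domain of $T$ is $\operatorname{dom}(T)=\{f\in\mathbb{H}: \{f,f'\}\in T \text{ for some } f'\in\mathbb{H}\}$. $T$ is positive if $\langle f',f\rangle\ge 0$ for all $\{f,f'\}\in T$. The adjoint of $T$ is the linear relation $$T^*=\{\{f,f'\}\in\mathbb{H}\times\mathbb{H}: \langle f',h\rangle=\langle f,h'\rangle \text{ for all } \{h,h'\}\in T\}.$$ A linear operator $S$ on $\mathbb{H}$ is a linear map $S:\operatorname{dom}(S)\to\mathbb{H}$ with $\operatorname{dom}(S)$ a linear subspace of $\mathbb{H}$ (not assumed everywhere defined, densely defined, closed or bounded); its graph is $G(S)=\{\{f,Sf\}: f\in\operatorname{dom}(S)\}$. $I$ is the identity operator on $\mathbb{H}$, and $\operatorname{ran}(I+S)=\{f+Sf: f\in\operatorname{dom}(S)\}$. *)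

(* Defs.v *)
From HB Require Import structures.
From mathcomp Require Import all_boot all_order all_algebra sesquilinear complex.
From mathcomp Require Import all_classical all_reals all_analysis.

Set Implicit Arguments.
Unset Strict Implicit.
Unset Printing Implicit Defensive.

Import Order.TTheory GRing.Theory Num.Theory.
Import numFieldNormedType.Exports.

Local Open Scope classical_set_scope.
Local Open Scope ring_scope.
Local Open Scope complex_scope.

(** A Hilbert space is real or complex: both cases are covered, the involution
    on the scalars being the identity, resp. complex conjugation. *)
Variant scalars := Real_scalars | Complex_scalars.

Definition scalar_field (R : realType) (k : scalars) : numFieldType :=
  match k with
  | Real_scalars => R
  | Complex_scalars => R[i]
  end.

Definition scalar_conj (R : realType) (k : scalars) :
    involutive_rmorphism (scalar_field R k) :=
  match k return involutive_rmorphism (scalar_field R k) with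
  | Real_scalars => @idfun R
  | Complex_scalars => @Num.conj R[i]
  end.

(** The form is linear in its first argument and [scalar_conj]-semilinear in
    the second one; the last field says that it induces the norm for which the
    space is complete. *)
Record hilbertType (R : realType) (k : scalars) := HilbertType {
  hilbert_sort :> completeNormedModType (scalar_field R k);
  inner : {dot hilbert_sort for scalar_conj R k};
  hilbert_normE : forall x : hilbert_sort, `|x| ^+ 2 = inner x x
}.

Arguments inner {R k h}.

Section LinearRelations.
Variables (R : realType) (k : scalars) (H : hilbertType R k).
Implicit Types (D : set H) (T : set (H * H)).

Definition orthogonal_complement D : set H :=
  [set x | forall y, D y -> inner x y = 0].

Definition linear_relation T : Prop := submod_closed [in T].

Definition rel_dom T : set H := [set f | exists f', T (f, f')].

(** In the complex case, [0 <= z] in [R[i]] means that [z] is real and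
    nonnegative. *)
Definition positive_relation T : Prop :=
  forall f f', T (f, f') -> 0 <= inner f' f.

Definition adjoint T : set (H * H) :=
  [set p | forall h h', T (h, h') -> inner p.2 h = inner p.1 h'].

(** The values of [op_fun] outside [op_dom] are irrelevant. *)
Record linear_operator := LinearOperator {
  op_dom : set H;
  op_fun :> H -> H;
  op_dom_submod : submod_closed [in op_dom];
  op_linear : forall (a : scalar_field R k) (x y : H),
    op_dom x -> op_dom y -> op_fun (a *: x + y) = a *: op_fun x + op_fun y
}.

Definition graph (S : linear_operator) : set (H * H) :=
  [set (f, S f) | f in op_dom S].

Definition ran_id_add (S : linear_operator) : set H :=
  [set f + S f | f in op_dom S].

End LinearRelations.

(* Main.v *)
(** (1) => (2): density of [dom T] makes the self-adjoint relation [T]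
    single-valued. Given [g], let [p_n] in [T] be such that [p_n.1 + p_n.2]
    minimizes the distance to [g]. Positivity gives
    [|f|, |f'| <= |f + f'|] on [T], so both components of [p_n] converge; the
    limit [l] lies in [T], which is closed as an adjoint, and
    [v = g - (l.1 + l.2)] is orthogonal to [ran (I + T)]. Thus [(v, -v)] is in
    [adjoint T = T], whence [v = 0] by positivity.

    (2) => (1): any [p] in [T] or in [adjoint T] has the same sum of components
    as some [q] in [T `&` adjoint T], so [p - q] has the form [(u, -u)]. Then
    [u = 0], by positivity in the first case and by
    [u _|_ ran (I + S)] in the second one. *)
Require Import Defs.
From mathcomp Require Import all_boot all_order all_algebra.
From mathcomp Require Import all_classical all_reals all_analysis.
From mathcomp Require Import complex sesquilinear ring.

Import Order.TTheory GRing.Theory Num.Theory.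
Import numFieldNormedType.Exports.

Local Open Scope classical_set_scope.
Local Open Scope ring_scope.

(** * Scalars, convergence along shrinking sets, and algebraic identities *)

Lemma mul_scalar_conj (R : realType) (k : scalars) (x : scalar_field R k) :
  x * scalar_conj R k x = `|x| ^+ 2.
Proof.
by case: k x => /= x; [rewrite -expr2 real_normK ?num_real | rewrite normCK].
Qed.

(** Nonnegative complex numbers are real, so the infimum of the real parts serves as [d]. Only here
    and in [mul_scalar_conj] are the two kinds of scalars separated. *)
Lemma scalar_inf_adherent (R : realType) (k : scalars)
    (A : set (scalar_field R k)) :
  A !=set0 -> (forall a, A a -> 0 <= a) ->
  exists2 d, forall a, A a -> d <= a &
    forall e, 0 < e -> exists2 a, A a & a < d + e.
Proof.
case: k A => /= A [a0 Aa0] A_ge0.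
  have lbA : has_lbound A by exists 0.
  exists (inf A) => [a Aa|e e0]; first exact: ge_inf.
  by apply: inf_adherent => //; split => //; exists a0.
have ImA a : A a -> complex.Im a = 0.
  by move=> /A_ge0; rewrite lecE /= => /andP[/eqP].
pose B := @complex.Re R @` A.
have lbB : has_lbound B.
  by exists 0 => _ [a /A_ge0 + <-]; rewrite lecE /= => /andP[].
exists (inf B)%:C%C => [a Aa|e].
  by rewrite lecE /= ImA // eqxx /=; apply: ge_inf => //; exists a.
rewrite ltcE /= => /andP[/eqP Ime Ree].
have [||_ [a Aa <-] lt_a] := @inf_adherent R B (complex.Re e) => //.
  by split => //; exists (complex.Re a0), a0.
exists a => //; rewrite ltcE /=; move: lt_a.
by case: e Ime Ree => x y /= -> _ ->; rewrite addr0 ImA // eqxx.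
Qed.

(** The sets [G e] are the base of a proper filter whose image under [f] is Cauchy; this avoids
    choosing a sequence. The 3 is 2 for the diameter plus 1 for a point of [G e] whose image is
    within [e] of the limit. *)
Lemma shrinking_cvg (K : numFieldType) (V : completeNormedModType K) (X : Type)
    (G : K -> set X) (f : X -> V) :
  (forall e, 0 < e -> G e !=set0) ->
  (forall d e, 0 < d -> d <= e -> G d `<=` G e) ->
  (forall e x y, 0 < e -> G e x -> G e y -> `|f x - f y| <= 2 * e) ->
  exists l, forall e x, 0 < e -> G e x -> `|l - f x| < 3 * e.
Proof.
move=> G0 Gle Gdiam.
pose F := filter_from [set e | 0 < e] G.
have Gmin i j : 0 < i -> 0 < j ->
    exists2 m, 0 < m & G m `<=` G i `&` G j.
  (* The order of [K] may be partial, but positive elements are real, hence comparable. *)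
  move=> i0 j0; have [ij|ji] := real_leP (gtr0_real i0) (gtr0_real j0).
    by exists i => // x Gx; split => //; apply: Gle Gx.
  by exists j => // x Gx; split => //; apply: Gle Gx => //; apply: ltW.
have FF : ProperFilter F.
  apply: filter_from_proper => //; apply: filter_from_filter => //.
  by exists 1 => /=.
have cvgF : cvg (f @ F).
  apply: cauchy_cvg; apply/cauchy_ballP => e e0.
  have e40 : 0 < e / 4 by rewrite divr_gt0.
  exists (f @` G (e / 4), f @` G (e / 4)) => /=.
    by split; exists (e / 4) => //= x Gx; exists x.
  move=> [_ _] /= [[x Gx <-] [y Gy <-]]; rewrite -ball_normE /ball_ /=.
  apply: le_lt_trans (Gdiam _ _ _ e40 Gx Gy) _.
  by rewrite mulrCA gtr_pMr // ltr_pdivrMr ?mul1r ?ltr_nat.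
have [l Fl] := (cvg_ex _).1 cvgF.
exists l => e x e0 Gx.
have [d d0 Gd] : F [set y | `|l - f y| < e] by move/cvgrPdist_lt: Fl => /(_ e e0).
have [m m0 Gm] := Gmin _ _ d0 e0.
have [y /Gm[/Gd lty Gy]] := G0 _ m0.
have -> : l - f x = (l - f y) + (f y - f x) by rewrite addrA subrK.
apply: le_lt_trans (ler_normD _ _) _.
have -> : 3 * e = e + 2 * e by ring.
by rewrite ltr_leD // Gdiam.
Qed.

Lemma set_submodP (K : pzRingType) (V : lmodType K) (M : set V) :
  submod_closed [in M] <->
  M 0 /\ forall (a : K) x y, M x -> M y -> M (a *: x + y).
Proof.
rewrite /submod_closed in_setE.
split=> -[M0 linM]; split=> // a x y; last by rewrite !in_setE; apply: linM.
by move: (linM a x y); rewrite !in_setE.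
Qed.

(** Used with [a = |v|^2], [b = <v, w>], [c = <w, v>] and [n = |w|^2]. *)
Lemma completing_square (F : fieldType) (a b c n : F) : n != 0 ->
  a + b * c / n ^+ 2 * n - (c / n * b + b / n * c) = a - b * c / n.
Proof. by move=> n0; field. Qed.

Lemma sub_antidiagonal (V : zmodType) (p q : V * V) :
  p.1 + p.2 = q.1 + q.2 -> p - q = (p.1 - q.1, - (p.1 - q.1)).
Proof.
move=> eq_pq; apply/pair_equal_spec; split=> //=.
by apply/eqP; rewrite -addr_eq0 addrC addrACA -opprD eq_pq subrr.
Qed.

Section InnerProduct.
Set Implicit Arguments.
Unset Strict Implicit.
Variables (R : realType) (k : scalars) (H : hilbertType R k).
Implicit Types (x y u v w : H) (T : set (H * H)).
Local Notation K := (scalar_field R k).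
Local Notation conj := (scalar_conj R k).

(** * Inner product identities and Cauchy-Schwarz *)

Lemma inner_conj x y : inner x y = conj (inner y x).
Proof. by rewrite hermC expr0 mul1r. Qed.

Lemma inner_scale_l (a : K) x y : inner (a *: x) y = a * inner x y.
Proof. exact: linearZl_LR. Qed.

Lemma inner_scale_r (a : K) x y : inner x (a *: y) = conj a * inner x y.
Proof. exact: linearZr_LR. Qed.

Lemma inner_opp_l x y : inner (- x) y = - inner x y.
Proof. exact: linearNl. Qed.

Lemma inner_add_r x y z : inner x (y + z) = inner x y + inner x z.
Proof. exact: linearDr. Qed.

Lemma sqr_normD x y :
  `|x + y| ^+ 2 = `|x| ^+ 2 + `|y| ^+ 2 + (inner x y + inner y x).
Proof. rewrite !hilbert_normE linearDl !linearDr /=; ring. Qed.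

Lemma sqr_normB x y :
  `|x - y| ^+ 2 = `|x| ^+ 2 + `|y| ^+ 2 - (inner x y + inner y x).
Proof. rewrite sqr_normD normrN linearNr linearNl /=; ring. Qed.

Lemma parallelogram x y :
  `|x + y| ^+ 2 + `|x - y| ^+ 2 = 2 * (`|x| ^+ 2 + `|y| ^+ 2).
Proof. rewrite sqr_normD sqr_normB; ring. Qed.

(* With [e = `|v|] the hypothesis is void and this is Cauchy-Schwarz. *)
Lemma near_minimal_inner v w (e : K) : 0 <= e ->
  (forall a : K, `|v| ^+ 2 <= `|v - a *: w| ^+ 2 + e ^+ 2) ->
  `|inner v w| <= e * `|w|.
Proof.
move=> e0 min_v; have [->|w0] := eqVneq w 0.
  by rewrite linear0r !normr0 mulr0.
have nw0 : 0 < `|w| ^+ 2 by rewrite exprn_gt0 // normr_gt0.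
have conjw : conj (`|w| ^+ 2) = `|w| ^+ 2.
  by rewrite hilbert_normE -inner_conj.
(* This coefficient gives the projection of [v] on the line of [w], the best choice of [a]. *)
have := min_v (inner v w / `|w| ^+ 2).
have -> : `|v - (inner v w / `|w| ^+ 2) *: w| ^+ 2 =
    `|v| ^+ 2 - `|inner v w| ^+ 2 / `|w| ^+ 2.
  rewrite sqr_normB normrZ exprMn inner_scale_l inner_scale_r.
  have -> : conj (inner v w / `|w| ^+ 2) = inner w v / `|w| ^+ 2.
    rewrite rmorphM fmorphV; congr (_ / _); last exact: conjw.
    exact/esym/inner_conj.
  have -> : `|inner v w / `|w| ^+ 2| ^+ 2 =
      inner v w * inner w v / (`|w| ^+ 2) ^+ 2.
    rewrite normf_div [X in _ / X]ger0_norm ?exprn_ge0 // expr_div_n.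
    by rewrite -mul_scalar_conj -inner_conj.
  rewrite -mul_scalar_conj -inner_conj.
  exact/completing_square/lt0r_neq0.
rewrite -addrA lerDl addrC subr_ge0 ler_pdivrMr // -exprMn.
by rewrite ler_pXn2r // nnegrE ?mulr_ge0.
Qed.

Lemma cauchy_schwarz x y : `|inner x y| <= `|x| * `|y|.
Proof.
by apply: near_minimal_inner => // a; rewrite lerDr exprn_ge0.
Qed.

(** * Almost-minimizers of the distance to a subspace *)

(** Parallelogram law for [g - x] and [g - y]: the midpoint of [x] and [y] lies in [M], so
    [|x - y|^2] is at most [4 (d + e^2) - 4 d]. *)
Lemma near_minimizers_close (M : set H) g (d e : K) x y :
  submod_closed [in M] -> 0 <= e ->
  (forall m, M m -> d <= `|g - m| ^+ 2) -> M x -> M y ->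
  `|g - x| ^+ 2 < d + e ^+ 2 -> `|g - y| ^+ 2 < d + e ^+ 2 ->
  `|x - y| <= 2 * e.
Proof.
move=> /set_submodP[M0 linM] e0 dM Mx My ltx lty.
have Mz : M (2^-1 *: (x + y)).
  rewrite -[_ *: _]addr0; apply/linM => //.
  by rewrite -[x]scale1r; apply: linM.
have gz : (g - x) + (g - y) = 2%:R *: (g - 2^-1 *: (x + y)).
  rewrite scalerBr scalerA divff ?pnatr_eq0 // scale1r scaler_nat mulr2n.
  by rewrite opprD addrACA.
have xy : (g - x) - (g - y) = y - x by rewrite opprB addrC addrA subrK.
have := parallelogram (g - x) (g - y).
rewrite gz xy normrZ exprMn normr_nat (distrC y x) => eq_xy.
rewrite -(@ler_pXn2r _ 2) ?nnegrE ?mulr_ge0 // exprMn.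
have -> : `|x - y| ^+ 2 =
    2 * (`|g - x| ^+ 2 + `|g - y| ^+ 2) - 2 ^+ 2 * `|g - 2^-1 *: (x + y)| ^+ 2.
  by apply: (canRL (addrK _)); rewrite -eq_xy [LHS]addrC.
have -> : 2 ^+ 2 * e ^+ 2 =
  2 * ((d + e ^+ 2) + (d + e ^+ 2)) - 2 ^+ 2 * d by ring.
rewrite lerB //; first by rewrite ler_pM2l ?lerD // ltW.
by rewrite ler_pM2l ?exprn_gt0 //; exact: dM.
Qed.

Lemma near_minimizer_inner (M : set H) g (d e : K) x w :
  submod_closed [in M] -> 0 <= e ->
  (forall m, M m -> d <= `|g - m| ^+ 2) -> M x -> M w ->
  `|g - x| ^+ 2 < d + e ^+ 2 -> `|inner (g - x) w| <= e * `|w|.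
Proof.
move=> /set_submodP[_ linM] e0 dM Mx Mw ltx.
apply: near_minimal_inner => // a; apply: le_trans (ltW ltx) _.
by rewrite lerD2r -addrA -opprD [x + _]addrC; apply/dM/linM.
Qed.

Lemma small_eq0 (c C : K) : 0 <= C ->
  (forall e, 0 < e -> `|c| <= e * C) -> c = 0.
Proof.
move=> C0 small; apply/eqP; apply: contraT => c0.
have nc0 : 0 < `|c| by rewrite normr_gt0.
have C1 : 0 < C + 1 by rewrite ltr_wpDl.
(* Adding 1 keeps the denominator positive when [C = 0]. *)
have := small (`|c| / (C + 1)) (divr_gt0 nc0 C1).
by rewrite mulrAC ler_pdivlMr // ler_pM2l // gerDl ler10.
Qed.

(** * The range of [I + T] and consequences of positivity *)

Definition ran_id_add_rel T : set H := [set p.1 + p.2 | p in T].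

Lemma ran_id_add_rel_submod T :
  linear_relation T -> submod_closed [in ran_id_add_rel T].
Proof.
move=> /set_submodP[T0 linT]; apply/set_submodP; split.
  by exists 0 => //=; rewrite addr0.
move=> a _ _ [p Tp <-] [q Tq <-]; exists (a *: p + q); first exact: linT.
by rewrite /= scalerDr addrACA.
Qed.

Lemma scalar_conj_ge0 (a : K) : 0 <= a -> 0 <= conj a.
Proof.
rewrite le0r => /orP[/eqP->|a0]; first by rewrite rmorph0.
by rewrite -(pmulr_rge0 _ a0) mul_scalar_conj exprn_ge0.
Qed.

(** Positivity makes the cross terms in the expansion of [|f + f'|^2] nonnegative. *)
Lemma positive_norm_le T p : positive_relation T -> T p ->
  `|p.1| <= `|p.1 + p.2| /\ `|p.2| <= `|p.1 + p.2|.
Proof.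
case: p => f f' posT Tp /=.
have ip0 : 0 <= inner f f' + inner f' f.
  by rewrite addr_ge0 ?(posT _ _ Tp) // inner_conj scalar_conj_ge0 ?(posT _ _ Tp).
split; rewrite -(@ler_pXn2r _ 2) ?nnegrE // sqr_normD -addrA.
  by rewrite lerDl addr_ge0 ?exprn_ge0.
by rewrite addrCA lerDl addr_ge0 ?exprn_ge0.
Qed.

Lemma inner_le x y (a : K) : `|x| <= a -> `|inner x y| <= a * `|y|.
Proof. by move=> xa; apply: le_trans (cauchy_schwarz x y) _; rewrite ler_wpM2r. Qed.

Lemma antidiagonal_eq0 T f : positive_relation T -> T (f, - f) -> f = 0.
Proof.
move=> posT /posT; rewrite inner_opp_l oppr_ge0 -hilbert_normE => f_le0.
by apply/eqP; rewrite -normr_eq0 -sqrf_eq0 eq_le f_le0 exprn_ge0.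
Qed.

(** * Self-adjoint relations: surjectivity of [I + T] and single-valuedness *)

Lemma selfadjoint_ran_id_add T : linear_relation T -> positive_relation T ->
  adjoint T = T -> ran_id_add_rel T = setT.
Proof.
move=> linT posT adjT; apply/seteqP; split => // g _.
have subM := ran_id_add_rel_submod linT; set M := ran_id_add_rel T in subM *.
have [T0 clT] := (set_submodP _ _ _).1 linT.
have [||d dlb dadh] := @scalar_inf_adherent R k [set `|g - m| ^+ 2 | m in M].
- by exists (`|g - 0| ^+ 2), 0 => //; case/set_submodP: subM.
- by move=> _ [m _ <-]; rewrite exprn_ge0.
have dM m : M m -> d <= `|g - m| ^+ 2 by move=> Mm; apply: dlb; exists m.
(* The tolerance is squared so that the diameter bound is linear in [e]. *)
pose G (e : K) := [set p | T p /\ `|g - (p.1 + p.2)| ^+ 2 < d + e ^+ 2].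
have MT p : T p -> M (p.1 + p.2) by exists p.
have G0 e : 0 < e -> G e !=set0.
  move=> e0; have [_ [_ [p Tp <-] <-] lt_p] := dadh _ (exprn_gt0 2 e0).
  by exists p.
have Gle a b : 0 < a -> a <= b -> G a `<=` G b.
  move=> a0 ab p [Tp lt_p]; split=> //; apply: lt_le_trans lt_p _.
  by rewrite lerD2l ler_pXn2r // nnegrE ?ltW // (lt_le_trans a0).
have Gdiam e p q : 0 < e -> G e p -> G e q ->
    `|p.1 - q.1| <= 2 * e /\ `|p.2 - q.2| <= 2 * e.
  move=> e0 [Tp lt_p] [Tq lt_q].
  have close := near_minimizers_close subM (ltW e0) dM (MT _ Tp) (MT _ Tq) lt_p lt_q.
  (* The sums of components are close; positivity of [T] at [p - q] passes this on to each
     component. *)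
  have Tpq : T (p - q) by rewrite -scaleN1r addrC; exact: clT.
  have [le1 le2] := positive_norm_le posT Tpq.
  split; [apply: le_trans le1 _ | apply: le_trans le2 _];
    by move: close; rewrite opprD addrACA.
have [l1 L1] := @shrinking_cvg _ _ _ G fst G0 Gle
  (fun e p q e0 Gp Gq => (Gdiam e p q e0 Gp Gq).1).
have [l2 L2] := @shrinking_cvg _ _ _ G snd G0 Gle
  (fun e p q e0 Gp Gq => (Gdiam e p q e0 Gp Gq).2).
have Tl : T (l1, l2).
  (* The identity defining the adjoint holds at every [p] in [G e], and replacing [p] by the limit
     costs at most [3 e (|h| + |h'|)]. *)
  rewrite -adjT => h h' Th /=; apply/eqP; rewrite -subr_eq0; apply/eqP.
  apply: (@small_eq0 _ (3 * `|h| + 3 * `|h'|)) => [|e e0].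
    by rewrite addr_ge0 ?mulr_ge0.
  have [p Gp] := G0 e e0.
  have adjp : inner p.2 h = inner p.1 h'.
    by case: Gp => + _; rewrite -{1}adjT; apply.
  have -> : inner l2 h - inner l1 h' = inner (l2 - p.2) h - inner (l1 - p.1) h'.
    by rewrite !linearBl /= adjp opprB addrA subrK.
  apply: le_trans (ler_normB _ _) _; rewrite mulrDr !mulrA ![e * 3]mulrC.
  by rewrite lerD // inner_le // ltW // (L1, L2).
pose v := g - (l1 + l2).
have orth w : M w -> inner v w = 0.
  (* 7 = 1 + 3 + 3: almost-orthogonality of [g - (p.1 + p.2)], then the errors of [l1] and [l2]. *)
  move=> Mw; apply: (@small_eq0 _ (7 * `|w|)) => [|e e0]; first by rewrite mulr_ge0.
  have [p Gp] := G0 e e0; have [Tp lt_p] := Gp.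
  have -> : inner v w =
      inner (g - (p.1 + p.2)) w - inner (l1 - p.1) w - inner (l2 - p.2) w.
    rewrite -!linearBl; congr (inner _ w); rewrite /v.
    have -> : l1 + l2 = (p.1 + p.2) + ((l1 - p.1) + (l2 - p.2)).
      by rewrite addrACA !subrKC.
    by move: (p.1 + p.2) (l1 - p.1) (l2 - p.2) => u a b; rewrite !opprD !addrA.
  have -> : e * (7 * `|w|) = e * `|w| + 3 * e * `|w| + 3 * e * `|w|.
    by rewrite mulrA -!mulrDl; congr (_ * _); ring.
  apply: le_trans (ler_normB _ _) _; apply: lerD; last first.
    by rewrite inner_le // ltW // L2.
  apply: le_trans (ler_normB _ _) _; apply: lerD; last first.
    by rewrite inner_le // ltW // L1.
  exact: near_minimizer_inner subM (ltW e0) dM (MT _ Tp) Mw lt_p.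
have Tv : T (v, - v).
  rewrite -adjT => h h' Th /=; apply/esym/eqP.
  by rewrite inner_opp_l -addr_eq0 -inner_add_r [h' + h]addrC orth //; exists (h, h').
have v0 := antidiagonal_eq0 posT Tv.
exists (l1, l2) => //=; apply/eqP; rewrite eq_sym -subr_eq0; exact/eqP.
Qed.

(** Two values of [T] at [f] have the same inner product [<f, h'>] with each [h] in the domain, so
    their difference is orthogonal to the domain. *)
Lemma selfadjoint_operator T : linear_relation T ->
  orthogonal_complement (rel_dom T) = [set 0] -> adjoint T = T ->
  exists S : linear_operator H, graph S = T.
Proof.
move=> linT dom0 adjT; have [T0 clT] := (set_submodP _ _ _).1 linT.
have mulT f f' f'' : T (f, f') -> T (f, f'') -> f' = f''.
  move=> Tf' Tf''; apply/eqP; rewrite -subr_eq0; apply/eqP.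
  suff: orthogonal_complement (rel_dom T) (f' - f'') by rewrite dom0.
  move=> h [h' Th]; rewrite linearBl.
  move: Tf' Tf''; rewrite -adjT => /(_ _ _ Th) /= -> /(_ _ _ Th) /= ->.
  by rewrite subrr.
pose s f := xget 0 [set f' | T (f, f')].
have sP f : rel_dom T f -> T (f, s f) by move=> Df; exact: (@xgetPex _ 0 [set f' | T (f, f')]).
have dom_sub : submod_closed [in rel_dom T].
  apply/set_submodP; split; first by exists 0.
  by move=> a x y [x' Tx] [y' Ty]; exists (a *: x' + y'); exact: clT Tx Ty.
have slin a x y : rel_dom T x -> rel_dom T y -> s (a *: x + y) = a *: s x + s y.
  move=> Dx Dy; have Txy := clT a _ _ (sP _ Dx) (sP _ Dy).
  by apply: (mulT _ _ _ _ Txy); apply: sP; exists (a *: s x + s y).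
exists (LinearOperator dom_sub slin); apply/seteqP; split.
  by move=> _ [f Df <-]; exact: sP.
move=> [f f'] Tf; have Df : rel_dom T f by exists f'.
by exists f => //=; rewrite (mulT _ _ _ Tf (sP _ Df)).
Qed.

(** * From surjectivity back to density and self-adjointness *)

Lemma ran_id_add_graph (S : linear_operator H) :
  ran_id_add S = ran_id_add_rel (graph S).
Proof.
apply/seteqP; split => g.
  by move=> [f Df <-]; exists (f, S f) => //; exists f.
by move=> [_ [f Df <-] <-]; exists f.
Qed.

(** The third hypothesis is what remains of having an operator [S]: the intersection is
    single-valued at 0. *)
Lemma symmetric_ran_id_add_selfadjoint T :
  linear_relation T -> positive_relation T ->
  (forall f', (T `&` adjoint T) (0, f') -> f' = 0) ->
  ran_id_add_rel (T `&` adjoint T) = setT ->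
  orthogonal_complement (rel_dom T) = [set 0] /\ adjoint T = T.
Proof.
move=> linT posT mul0 ranT; have [T0 clT] := (set_submodP _ _ _).1 linT.
have surj g : exists p, [/\ T p, adjoint T p & p.1 + p.2 = g].
  have : [set: H] g by [].
  by rewrite -ranT => -[p [Tp Ap] <-]; exists p.
have Tadj : T `<=` adjoint T.
  move=> p Tp; have [q [Tq Aq /esym/sub_antidiagonal eq_pq]] := surj (p.1 + p.2).
  have Tpq : T (p - q) by rewrite -scaleN1r addrC; exact: clT.
  suff -> : p = q by [].
  apply/eqP; rewrite -subr_eq0 eq_pq; move: Tpq; rewrite eq_pq.
  by move=> /(antidiagonal_eq0 posT) ->; rewrite oppr0.
split; apply/seteqP; split=> //.
(* With [g = f + f'], orthogonality to [f] gives [|f|^2 + <f', f> = 0], both terms being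
   nonnegative. So [f = 0], and [g = f'] is a value at 0. *)
- move=> g orth; have [[f f'] [Tp Ap /= eq_g]] := surj g.
  have f0 : f = 0.
    have /eqP : inner g f = 0 by apply: orth; exists f'.
    rewrite -eq_g linearDl /= -hilbert_normE paddr_eq0 ?exprn_ge0 ?(posT _ _ Tp) //.
    by rewrite sqrf_eq0 normr_eq0 => /andP[/eqP].
  by move: Tp Ap; rewrite -eq_g f0 add0r => Tp Ap; apply: mul0.
- by move=> _ -> h _; rewrite linear0l.
- move=> p Ap; have [q [Tq Aq /esym/sub_antidiagonal eq_pq]] := surj (p.1 + p.2).
  suff -> : p = q by [].
  apply/eqP; rewrite -subr_eq0 eq_pq.
  (* Write [u = p.1 - q.1] as [h + h'] with [(h, h')] in [T]. Testing [(u, -u)], which lies in the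
     adjoint, against this pair gives [<u, h + h'> = |u|^2 = 0]. *)
  have [[h h'] [Th _ /= eq_u]] := surj (p.1 - q.1).
  have := congr2 (fun a b => a - b) (Ap _ _ Th) (Aq _ _ Th).
  rewrite -!linearBl /= -[p.2 - q.2]/(p - q).2 eq_pq /= => /eqP.
  rewrite inner_opp_l eq_sym -addr_eq0 -inner_add_r [h' + h]addrC eq_u -hilbert_normE.
  by rewrite sqrf_eq0 normr_eq0 => /eqP ->; rewrite oppr0.
Qed.

End InnerProduct.

Theorem theorem3p15 (R : realType) (k : scalars) (H : hilbertType R k)
    (T : set (H * H)) (linT : linear_relation T) (posT : positive_relation T) :
  (orthogonal_complement (rel_dom T) = [set 0] /\ adjoint T = T) <->
  (exists S : linear_operator H,
     graph S = T `&` adjoint T /\ ran_id_add S = setT).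
Proof.
split=> [[dom0 adjT]|[S [graphS ranS]]].
  have [S graphS] := selfadjoint_operator linT dom0 adjT.
  exists S; rewrite ran_id_add_graph graphS adjT setIid; split=> //.
  exact: selfadjoint_ran_id_add.
apply: symmetric_ran_id_add_selfadjoint => //.
  move=> f'; rewrite -graphS => -[x + [x0 <-]]; rewrite x0 => D0.
  (* The scalar -1 with both vectors 0 turns linearity into [S 0 = - S 0 + S 0]. *)
  by have := op_linear (-1) D0 D0; rewrite scaler0 addr0 scaleN1r addNr.
by rewrite -graphS -ran_id_add_graph.
Qed.
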